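(* There exist constancy logic formulas which are not equivalent to any inclusion logic formula; that is, there is a constancy logic formula $\phi$ such that for no inclusion logic formula $\phi'$ does $M\models_X\phi\Leftrightarrow M\models_X\phi'$ hold for all models $M$ of the relevant signature and all teams $X$ over $M$ whose domain contains the free variables of both formulas.
   Context: All first order models are assumed to have at least two elements in their domain; $\mathrm{Dom}(M)$ is the domain of $M$. An assignment over $M$ is a function from a set of variables to $\mathrm{Dom}(M)$; $s[m/x]$ is the assignment which sends $x$ to $m$ and otherwise agrees with $s$; $t\langle s\rangle$ is the value of the term $t$ in $M$ under $s$, and $\vec t\langle s\rangle$ is the corresponding tuple of values. A team $X$ over $M$ is a set of assignments over $M$ all having the same domain, called the domain of $X$. All formulas are in negation normal form and are built using $\wedge,\vee,\exists x,\forall x$ from first order literals together with: for constancy logic, constancy atoms $=\!(t)$ ($t$ a term); for inclusion logic, inclusion atoms $\vec t_1\subseteq\vec t_2$ (with $\vec t_1,\vec t_2$ finite tuples of terms of the same length). The satisfaction relation $M\models_X\phi$ (lax team semantics), where the domain of $X$ contains the free variables of $\phi$, is: - for a first order literal $\phi$: $M\models_s\phi$ (Tarski) for all $s\in X$; - $M\models_X =\!(t)$ iff $t\langle s\rangle=t\langle s'\rangle$ for all $s,s'\in X$; - $M\models_X \vec t_1\subseteq\vec t_2$ iff for every $s\in X$ there is $s'\in X$ with $\vec t_1\langle s\rangle=\vec t_2\langle s'\rangle$; - $M\models_X\psi\vee\theta$ iff $X=Y\cup Z$ for some teams $Y,Z$ with $M\models_Y\psi$ and $M\models_Z\theta$;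 - $M\models_X\psi\wedge\theta$ iff $M\models_X\psi$ and $M\models_X\theta$; - $M\models_X\exists x\psi$ iff there is $H:X\to\mathcal P(\mathrm{Dom}(M))\setminus\{\emptyset\}$ with $M\models_{X[H/x]}\psi$, where $X[H/x]=\{s[m/x]:s\in X,\ m\in H(s)\}$; - $M\models_X\forall x\psi$ iff $M\models_{X[M/x]}\psi$, where $X[M/x]=\{s[m/x]:s\in X,\ m\in\mathrm{Dom}(M)\}$. *)

(* Defs.v *)
(* MathComp, with the sets of MathComp-Analysis' classical layer. *)
From mathcomp Require Import all_boot.
From mathcomp Require Import boolp classical_sets.

Set Implicit Arguments.
Unset Strict Implicit.
Unset Printing Implicit Defensive.

Local Open Scope classical_set_scope.

Record signature := Signature {
  fsym : Type;
  farity : fsym -> nat;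
  rsym : Type;
  rarity : rsym -> nat
}.

Record model (S : signature) := Model {
  Dom :> Type;
  Dom_two : exists a b : Dom, a <> b;
  finterp : forall f : fsym S, (farity f).-tuple Dom -> Dom;
  rinterp : forall R : rsym S, (rarity R).-tuple Dom -> Prop
}.

Definition var := nat.

Inductive term (S : signature) :=
  | Var of var
  | App (f : fsym S) of 'I_(farity f) -> term S.

(* Both logics live in one syntax; [constancy_logic] and [inclusion_logic]
   below carve them out. Negation occurs in the literals [Neq], [NRel] only. *)
Inductive formula (S : signature) :=
  | Eq of term S & term S
  | Neq of term S & term S
  | Rel (R : rsym S) of 'I_(rarity R) -> term S
  | NRel (R : rsym S) of 'I_(rarity R) -> term S
  | Const of term S
  | Incl (n : nat) of 'I_n -> term S & 'I_n -> term S
  | And of formula S & formula S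
  | Or of formula S & formula S
  | Ex of var & formula S
  | All of var & formula S.

Fixpoint constancy_logic S (phi : formula S) : bool :=
  match phi with
  | Incl _ _ _ => false
  | And p q | Or p q => constancy_logic p && constancy_logic q
  | Ex _ p | All _ p => constancy_logic p
  | _ => true
  end.

Fixpoint inclusion_logic S (phi : formula S) : bool :=
  match phi with
  | Const _ => false
  | And p q | Or p q => inclusion_logic p && inclusion_logic q
  | Ex _ p | All _ p => inclusion_logic p
  | _ => true
  end.

Fixpoint tvars S (t : term S) : set var :=
  match t with
  | Var x => [set x]
  | App f ts => \bigcup_i tvars (ts i)
  end.

Fixpoint fv S (phi : formula S) : set var :=
  match phi with
  | Eq t u | Neq t u => tvars t `|` tvars u
  | Rel R ts | NRel R ts => \bigcup_i tvars (ts i)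
  | Const t => tvars t
  | Incl n ts us => \bigcup_i (tvars (ts i) `|` tvars (us i))
  | And p q | Or p q => fv p `|` fv q
  | Ex x p | All x p => fv p `\` [set x]
  end.

(* All the values of [g], if they are all defined: [pmap] drops the undefined
   ones and [insub] checks that none was dropped. *)
Definition all_some T n (g : 'I_n -> option T) : option (n.-tuple T) :=
  insub (pmap g (enum 'I_n)).

Section Semantics.
Variables (S : signature) (M : model S).

(* A function from a set of variables to Dom(M): [None] off that set. *)
Definition assignment := var -> option M.

Implicit Types (s : assignment) (X : set assignment).

Definition adom s : set var := [set x | s x].

Definition upd s (x : var) (m : M) : assignment := [eta s with x |-> Some m].

(* [X] is a team with domain [W]. The domain is a separate argument because
   the empty team does not determine it. *)
Definition is_team (W : set var) X : Prop := forall s, X s -> adom s = W.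

(* [None] exactly when some variable of [t] is outside the domain of [s]. *)
Fixpoint term_val s (t : term S) : option M :=
  match t with
  | Var x => s x
  | App f ts => omap (@finterp S M f) (all_some (fun i => term_val s (ts i)))
  end.

Definition terms_val s n (ts : 'I_n -> term S) : option (n.-tuple M) :=
  all_some (fun i => term_val s (ts i)).

(* X[H/x] *)
Definition supplement X (x : var) (H : assignment -> set M) : set assignment :=
  \bigcup_(s in X) (upd s x @` H s).

(* X[M/x] *)
Definition duplicate X (x : var) : set assignment :=
  \bigcup_(s in X) (upd s x @` setT).

(* Meaningful when the domain of [X] contains the free variables of [phi].
   In the clause for [Ex], only the values of [H] on [X] matter. *)
Fixpoint sat X (phi : formula S) : Prop :=
  match phi with
  | Eq t u => forall s, X s -> term_val s t = term_val s u
  | Neq t u => forall s, X s -> term_val s t <> term_val s u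
  | Rel R ts => forall s, X s -> exists2 v, terms_val s ts = Some v & rinterp v
  | NRel R ts => forall s, X s -> exists2 v, terms_val s ts = Some v & ~ rinterp v
  | Const t => forall s s', X s -> X s' -> term_val s t = term_val s' t
  | Incl n ts us => forall s, X s ->
      exists2 s', X s' & terms_val s ts = terms_val s' us
  | And p q => sat X p /\ sat X q
  | Or p q => exists Y Z, [/\ X = Y `|` Z, sat Y p & sat Z q]
  | Ex x p => exists2 H : assignment -> set M,
      (forall s, X s -> H s !=set0) & sat (supplement X x H) p
  | All x p => sat (duplicate X x) p
  end.

End Semantics.

Definition equivalent S (phi psi : formula S) : Prop :=
  forall (M : model S) (W : set var) (X : set (assignment M)),
    is_team W X -> fv phi `|` fv psi `<=` W -> sat X phi <-> sat X psi.

(* Main.v *)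
(** Inclusion logic formulas are closed under unions of teams, while a constancy
    atom holds in each of two singleton teams without holding in their union. *)
Require Import Defs.
From mathcomp Require Import all_boot.
From mathcomp Require Import boolp classical_sets.

Set Implicit Arguments.
Unset Strict Implicit.
Unset Printing Implicit Defensive.

Local Open Scope classical_set_scope.

(** The obstruction is union closure ([inclusion_logic_satU]), proved by induction on the formula. A
    constancy atom on a variable holds in every one-assignment team, so an equivalent inclusion
    logic formula would hold there too, hence also in the union of two such teams whose assignments
    give the variable different values, where the atom fails. *)

Lemma duplicateU S (M : model S) (X Y : set (assignment M)) x :
  duplicate (X `|` Y) x = duplicate X x `|` duplicate Y x.
Proof. exact: bigcup_setU. Qed.

(** Each choice function is restricted to its own team: [H] may take arbitrary values off [X], and
    these must not reach assignments lying only in [Y]. An assignment in both teams receives both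
    sets of values, as lax semantics permits. *)
Lemma supplementU S (M : model S) (X Y : set (assignment M)) x
    (H K : assignment M -> set M) :
  supplement (X `|` Y) x
    (fun s => [set m | X s /\ H s m] `|` [set m | Y s /\ K s m]) =
  supplement X x H `|` supplement Y x K.
Proof.
apply/seteqP; split=> [t [s _ [m [[Xs Hm]|[Ys Km]] <-]]|t].
- by left; exists s => //; exists m.
- by right; exists s => //; exists m.
case=> -[s Zs [m Hm <-]]; exists s; [by left| |by right|]; exists m => //.
- by left.
- by right.
Qed.

(** Witnesses for inclusion atoms survive in a larger team; splittings for disjunctions are united
    componentwise, and choice functions are merged as in [supplementU]. *)
Lemma inclusion_logic_satU S (M : model S) (phi : formula S)
    (X Y : set (assignment M)) :
  inclusion_logic phi -> sat X phi -> sat Y phi -> sat (X `|` Y) phi.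
Proof.
elim: phi X Y => [t u|t u|R ts|R ts|t|n ts us|p IHp q IHq|p IHp q IHq|x p IHp
  |x p IHp] X Y //=.
- by move=> _ hX hY s [/hX|/hY].
- by move=> _ hX hY s [/hX|/hY].
- by move=> _ hX hY s [/hX|/hY].
- by move=> _ hX hY s [/hX|/hY].
- by move=> _ hX hY s [/hX|/hY] [s' ? ?]; exists s' => //; [left|right].
- by move=> /andP[ip iq] [? ?] [? ?]; split; [apply: IHp|apply: IHq].
- move=> /andP[ip iq] [X1 [X2 [-> ? ?]]] [Y1 [Y2 [-> ? ?]]].
  by exists (X1 `|` Y1), (X2 `|` Y2); split;
    [rewrite setUACA|apply: IHp|apply: IHq].
- move=> ip [H H0 pH] [K K0 pK].
  exists (fun s => [set m | X s /\ H s m] `|` [set m | Y s /\ K s m]).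
    move=> s [Xs|Ys].
      by have [m ?] := H0 s Xs; exists m; left.
    by have [m ?] := K0 s Ys; exists m; right.
  by rewrite supplementU; apply: IHp.
- by move=> ip ? ?; rewrite duplicateU; apply: IHp.
Qed.

Lemma bool_two : exists a b : bool, a <> b.
Proof. by exists true, false. Qed.

Definition bool_model (S : signature) : model S :=
  @Model S bool bool_two (fun _ _ => true) (fun _ _ => False).

(** Being defined on all variables, these assignments suit any candidate formula, whatever its free
    variables. *)
Definition const_assignment S (b : bool) : assignment (bool_model S) :=
  fun=> Some b.

Lemma is_team_const_assignment S (X : set (assignment (bool_model S))) :
  X `<=` range (@const_assignment S) -> is_team setT X.
Proof. by move=> sX s /sX[b _ <-]; apply/seteqP; split. Qed.

Theorem corollary4p12 (S : signature) :
  exists phi : formula S, constancy_logic phi /\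
    ~ exists phi' : formula S, inclusion_logic phi' /\ equivalent phi phi'.
Proof.
exists (Const (Var S 0)); split=> // -[psi [ipsi eqv]].
have eqvX (X : set (assignment (bool_model S))) :
    X `<=` range (@const_assignment S) -> sat X (Const (Var S 0)) <-> sat X psi.
  by move=> /is_team_const_assignment tX; apply: eqv tX _.
have psi1 b : sat [set @const_assignment S b] psi.
  by apply/eqvX => [_ ->|_ _ -> ->] //; exists b.
set X := [set @const_assignment S true] `|` [set @const_assignment S false].
have XP : X `<=` range (@const_assignment S).
  by move=> s [->|->]; [exists true|exists false].
have /(eqvX _ XP) const0 : sat X psi by apply: inclusion_logic_satU.
by have := const0 _ _ (or_introl erefl) (or_intror erefl).
Qed.
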